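(* Let $m, r \in \mathbb{N}$ with $r \ge 1$ and $m > r$. Then $$\sum_{n=1}^\infty\frac{H_n^{(r)}}{n^m} = -\frac{1}{\Gamma(m)}\int_0^\infty \frac{t^{m-1}\ln(1-e^{-t})}{(1-e^{-t})^r} \, dt,$$ where $H_n^{(r)}$ denotes the $n$-th hyperharmonic number of order $r$.
   Context: The hyperharmonic numbers are defined recursively by $H_n^{(0)} = \frac{1}{n}$ for $n \ge 1$ and $H_n^{(r)} = \sum_{k=1}^{n} H_k^{(r-1)}$ for $r, n \ge 1$. In particular $H_n^{(1)} = H_n = 1 + \frac12 + \cdots + \frac1n$ is the ordinary harmonic number. $\Gamma$ denotes the Gamma function. *)

(* Defs.v *)
From mathcomp Require Import all_boot all_order all_algebra.
From mathcomp Require Import all_classical all_reals all_analysis.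

Set Implicit Arguments.
Unset Strict Implicit.
Unset Printing Implicit Defensive.

Import Order.TTheory GRing.Theory Num.Theory.
Import numFieldNormedType.Exports.

Local Open Scope classical_set_scope.
Local Open Scope ring_scope.

(* [hyperharmonic R r n] is $H_n^{(r)}$, meaningful for n >= 1; at n = 0 it is
   a junk value equal to 0, which no sum below uses. *)
Fixpoint hyperharmonic (R : realType) (r n : nat) : R :=
  if r is r'.+1 then \sum_(1 <= k < n.+1) hyperharmonic R r' k
  else n%:R^-1.

(* Euler's integral of the second kind; meaningful for 0 < x. *)
Definition Gamma (R : realType) (x : R) : R :=
  \int[lebesgue_measure]_(t in `]0, +oo[) (t `^ (x - 1) * expR (- t)).

Definition hyperharmonic_integrand (R : realType) (m r : nat) (t : R) : R :=
  t ^+ m.-1 * ln (1 - expR (- t)) / (1 - expR (- t)) ^+ r.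

(* Main.v *)
Require Import Defs.
From mathcomp Require Import all_boot all_order all_algebra.
From mathcomp Require Import all_classical all_reals all_analysis.
From mathcomp Require Import measurable_realfun ring lra.
Import Order.TTheory GRing.Theory Num.Theory.
Import numFieldNormedType.Exports.
Local Open Scope classical_set_scope.
Local Open Scope ring_scope.

(* With [x = e^{-t}], the generating function of the hyperharmonic numbers is
   [\sum_n H_n^(r) x^n = - ln (1 - x) / (1 - x)^r] (each summation over the
   index divides by [1 - x]), and [\int_0^oo t^(m-1) e^{-nt} dt = (m-1)! / n^m].
   All terms are nonnegative, so monotone convergence exchanges sum and integral;
   finiteness holds because [H_n^(r) <= n^(r-1) H_n], which reduces the case
   [m > r] to the convergence of [\sum_n H_n / n^2]. *)

Lemma is_derive_exprn {R : realType} n (x : R) :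
  is_derive x (1 : R) (fun x => x ^+ n) (n%:R * x ^+ n.-1).
Proof.
have := is_deriveX n (is_derive_id x (1 : R)).
by rewrite exprfctE /GRing.scale /= mulr1.
Qed.

(** * Growth of the hyperharmonic numbers and boundedness of the partial sums *)

Section Growth.
Context {R : realType}.
Implicit Types r n m : nat.

Lemma hyperharmonicSS r n :
  hyperharmonic R r.+1 n.+1 = hyperharmonic R r.+1 n + hyperharmonic R r n.+1.
Proof. by rewrite /= big_nat_recr. Qed.

Lemma hyperharmonicS0 r : hyperharmonic R r.+1 0 = 0.
Proof. by rewrite /= big_geq. Qed.

Lemma hyperharmonic_ge0 r n : 0 <= hyperharmonic R r n.
Proof.
elim: r n => [|r ih] n /=; first by rewrite invr_ge0.
by apply: sumr_ge0 => k _; exact: ih.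
Qed.

Lemma hyperharmonic_homo r :
  {homo hyperharmonic R r.+1 : n p / (n <= p)%N >-> n <= p}.
Proof.
apply: homo_leq => [x|y x z|n]; [exact: lexx|exact: le_trans|].
by rewrite hyperharmonicSS lerDl hyperharmonic_ge0.
Qed.

(** Induction on [r]: the defining sum has n terms, and the induction hypothesis bounds the k-th by
    k^r H_k, hence by n^r H_n since both factors grow with k. *)
Lemma hyperharmonic_le_harmonic r n :
  hyperharmonic R r.+1 n <= n%:R ^+ r * hyperharmonic R 1 n.
Proof.
elim: r n => [|r ih] n; first by rewrite expr0 mul1r.
rewrite [leLHS]/= -/(hyperharmonic R r.+1).
apply: (@le_trans _ _ (\sum_(1 <= k < n.+1) n%:R ^+ r * hyperharmonic R 1 n)).
  rewrite big_nat_cond [leRHS]big_nat_cond; apply: ler_sum => k.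
  rewrite andbT => /andP[_]; rewrite ltnS => kn.
  apply: (le_trans (ih k)); apply: ler_pM.
  - by rewrite exprn_ge0.
  - exact: hyperharmonic_ge0.
  - by rewrite lerXn2r ?nnegrE // ler_nat.
  - exact: hyperharmonic_homo.
by rewrite sumr_const_nat subSS subn0 -[leLHS]mulr_natl mulrA -exprS.
Qed.

(* [(H_n + 1) / n] telescopes: its decrement dominates [H_n / n^2]. *)
Lemma sum_harmonic_div_sqr_le n :
  \sum_(1 <= k < n.+2) hyperharmonic R 1 k / k%:R ^+ 2
    <= 3 - (hyperharmonic R 1 n.+1 + 1) / n.+1%:R.
Proof.
elim: n => [|n ih].
  (* Equality holds here, 1 = 3 - (1 + 1) / 1; this fixes the constant 3. *)
  rewrite big_nat1 hyperharmonicSS hyperharmonicS0 /=; lra.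
rewrite big_nat_recr //= -/(hyperharmonic R 1).
apply: (le_trans (lerD ih (lexx _))).
have -> : \sum_(1 <= k < n.+3) k%:R^-1 = hyperharmonic R 1 n.+1 + n.+2%:R^-1 :> R.
  by rewrite -hyperharmonicSS.
have := hyperharmonic_ge0 1 n.+1; move: (hyperharmonic R 1 n.+1) => h h0.
rewrite -[n.+2]addn1 natrD; set x : R := n.+1%:R.
have x0 : 0 < x by rewrite ltr0n.
rewrite -subr_ge0.
(* [lhs] is the decrement of (H_n + 1) / n minus the new term of the sum; its closed form is visibly
   nonnegative for h >= 0 and x > 0. *)
set lhs := (X in 0 <= X).
have -> : lhs = (h * (x + 1) + 1) / (x * (x + 1) ^+ 3).
  by rewrite /lhs; field; lra.
apply: divr_ge0; first by nra.
by rewrite mulr_ge0 ?exprn_ge0 //; lra.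
Qed.

(** Since H_k^(r) <= k^(r-1) H_k and r + 1 <= m, each term is at most H_k / k^2. The bound is
    uniform in [n], so the monotone partial sums converge. *)
Lemma hyperharmonic_partial_sum_le m r n : (1 <= r)%N -> (r < m)%N ->
  \sum_(1 <= k < n.+1) hyperharmonic R r k / k%:R ^+ m <= 3.
Proof.
case: r => // r _ rm.
apply: (@le_trans _ _ (\sum_(1 <= k < n.+1) hyperharmonic R 1 k / k%:R ^+ 2)).
  rewrite big_nat_cond [leRHS]big_nat_cond; apply: ler_sum => k.
  rewrite andbT => /andP[k1 _].
  have k0 : 0 < k%:R :> R by rewrite ltr0n.
  rewrite ler_pdivrMr ?exprn_gt0 // mulrAC ler_pdivlMr ?exprn_gt0 //.
  apply: (@le_trans _ _ (k%:R ^+ r * hyperharmonic R 1 k * k%:R ^+ 2)).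
    by rewrite ler_wpM2r ?exprn_ge0 ?hyperharmonic_le_harmonic // ltW.
  rewrite mulrAC -exprD mulrC ler_wpM2l ?hyperharmonic_ge0 //.
  by rewrite ler_weXn2l ?ler1n // addn2.
case: n => [|n]; first by rewrite big_geq.
apply: (le_trans (sum_harmonic_div_sqr_le n)).
by rewrite gerBl divr_ge0 // addr_ge0 ?hyperharmonic_ge0.
Qed.

(** The weight [c] is left free to cover the three series in play, with weights x^k, 1 / k^m and
    t^(m-1) e^(-kt). *)
Lemma hyperharmonic_series_homo r (c : nat -> R) : (forall k, 0 <= c k) ->
  {homo (fun n => \sum_(1 <= k < n.+1) hyperharmonic R r k * c k)
    : n p / (n <= p)%N >-> n <= p}.
Proof.
move=> c0; apply: homo_leq => [x|y x z|n]; [exact: lexx|exact: le_trans|].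
by rewrite [leRHS]big_nat_recr //= lerDl mulr_ge0 ?hyperharmonic_ge0.
Qed.

End Growth.

(** * Generating function of the hyperharmonic numbers on [0, 1) *)

Section GeneratingFunction.
Context {R : realType}.
Implicit Types (r n : nat) (x : R).

(** The remainder [F n] has derivative 1 / (1 - y) minus a geometric sum, that is y^n / (1 - y). The
    mean value theorem then gives 0 <= F n x <= x^n / (1 - x), which tends to 0. *)
Lemma ln1Bx_series x : 0 <= x < 1 ->
  (fun n => \sum_(1 <= k < n.+1) hyperharmonic R 0 k * x ^+ k) @ \oo
    --> - ln (1 - x).
Proof.
move=> /andP[x0 x1].
pose F n y : R := - ln (1 - y) - \sum_(1 <= k < n.+1) hyperharmonic R 0 k * y ^+ k.
have dF n (y : R) : y < 1 -> is_derive y (1 : R) (F n) (y ^+ n / (1 - y)).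
  move=> y1.
  have y1' : 0 < 1 - y by rewrite subr_gt0.
  elim: n => [|n ih].
    have -> : F 0%N = fun y : R => - ln (1 - y).
      by apply/funext => z; rewrite /F big_geq // subr0.
    have dl := is_derive1_ln y1'.
    have dB : is_derive y (1 : R) (fun z : R => 1 - z) (- 1).
      by apply: is_derive_eq; rewrite add0r mul1r.
    have dlB := @is_derive1_comp _ (@ln R) (fun z : R => 1 - z) y _ _ dl dB.
    have : is_derive y (1 : R) (fun z : R => - ln (1 - z)) (- ((1 - y)^-1 * (- 1))).
      exact: is_deriveN.
    by rewrite expr0 mulrN1 opprK div1r.
  have -> : F n.+1 = fun y => F n y - n.+1%:R^-1 * y ^+ n.+1.
    by apply/funext => z; rewrite /F big_nat_recr //= opprD addrA.
  have dX := is_deriveZ n.+1%:R^-1 (is_derive_exprn n.+1 y).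
  apply: (is_derive_eq (is_deriveB ih dX)).
  rewrite /GRing.scale /= exprS; field.
  by rewrite nat1r pnatr_eq0 andbT gt_eqF.
have Fb n : 0 <= F n x <= x ^+ n / (1 - x).
  have [||c] := @MVT_segment _ (F n) (fun y => y ^+ n / (1 - y)) 0 x x0.
  - by move=> y; rewrite in_itv /= => /andP[_ yx]; apply: dF; exact: lt_trans x1.
  - apply: derivable_within_continuous => y; rewrite in_itv /= => /andP[_ yx].
    by have [] := dF n y (le_lt_trans yx x1).
  rewrite in_itv /= => /andP[c0 cx].
  (* The sum starts at k = 1, so only positive powers of 0 occur. *)
  have -> : F n 0 = 0.
    rewrite /F subr0 ln1 oppr0 sub0r big_nat_cond big1 ?oppr0 // => k.
    by case: k => // k _; rewrite expr0n /= mulr0.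
  rewrite !subr0 => ->.
  have c1 : 0 < 1 - c by lra.
  have xc : (1 - c)^-1 <= (1 - x)^-1 by rewrite lef_pV2 ?posrE; lra.
  have ci : 0 <= (1 - c)^-1 by rewrite invr_ge0 ltW.
  rewrite !mulr_ge0 ?exprn_ge0 //=.
  (* First drop the interval length x <= 1, then use that y^n / (1 - y) increases on [0, 1). *)
  apply: (@le_trans _ _ (c ^+ n / (1 - c))).
    by rewrite ler_piMr ?mulr_ge0 ?exprn_ge0 // ltW.
  by rewrite ler_pM ?exprn_ge0 // lerXn2r ?nnegrE.
have F0 : F ^~ x @ \oo --> 0.
  apply: (@squeeze_cvgr _ _ _ _ (cst 0) (fun n => x ^+ n / (1 - x))).
  - exact: nearW.
  - exact: cvg_cst.
  - rewrite -[X in _ --> X](mul0r (1 - x)^-1); apply: cvgMr_tmp.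
    by apply: cvg_expr; rewrite ger0_norm.
have -> : (fun n => \sum_(1 <= k < n.+1) hyperharmonic R 0 k * x ^+ k)
        = (fun n => - ln (1 - x) - F n x).
  by apply/funext => n; rewrite /F opprB addrC subrK.
rewrite -[X in _ --> X]subr0; apply: cvgB F0; exact: cvg_cst.
Qed.

Lemma hyperharmonic_series r x : 0 <= x < 1 ->
  (fun n => \sum_(1 <= k < n.+1) hyperharmonic R r k * x ^+ k) @ \oo
    --> - ln (1 - x) / (1 - x) ^+ r.
Proof.
move=> x01; have /andP[x0 x1] := x01.
have x1' : 0 < 1 - x by rewrite subr_gt0.
elim: r => [|r ih]; first by rewrite expr0 divr1; exact: ln1Bx_series.
set S := fun r n => \sum_(1 <= k < n.+1) hyperharmonic R r k * x ^+ k.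
have SS q n : S q n.+1 = S q n + hyperharmonic R q n.+1 * x ^+ n.+1.
  by rewrite /S big_nat_recr.
(* Abel summation: multiplying by 1 - x turns the coefficients H_k^(r+1) into their increments
   H_k^(r), up to a boundary term. *)
have SE n : S r.+1 n = (S r n - x ^+ n.+1 * hyperharmonic R r.+1 n) / (1 - x).
  elim: n => [|n ihn].
    by rewrite /S !big_geq // hyperharmonicS0 mulr0 subrr mul0r.
  rewrite !SS ihn hyperharmonicSS !exprS.
  by field; lra.
(* The bounded partial sums converge, so their increments
   [x ^+ n * hyperharmonic R r.+1 n], which control the error term in [SE],
   tend to 0. *)
have Sbig n : S r.+1 n <= - ln (1 - x) / (1 - x) ^+ r / (1 - x).
  rewrite SE; apply: ler_wpM2r; first by rewrite invr_ge0 ltW.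
  apply: (@le_trans _ _ (S r n)).
    by rewrite gerBl mulr_ge0 ?exprn_ge0 ?hyperharmonic_ge0.
  rewrite -(cvg_lim _ ih) //; apply: nondecreasing_cvgn_le; last exact: cvgP ih.
  by apply: hyperharmonic_series_homo => k; rewrite exprn_ge0.
have Scvg : cvgn (S r.+1).
  apply: nondecreasing_is_cvgn.
    by apply: hyperharmonic_series_homo => k; rewrite exprn_ge0.
  by exists (- ln (1 - x) / (1 - x) ^+ r / (1 - x)) => _ [n _ <-].
have H0 : (fun n => x ^+ n.+1 * hyperharmonic R r.+1 n.+1) @ \oo --> (0 : R).
  have -> : (fun n => x ^+ n.+1 * hyperharmonic R r.+1 n.+1)
          = (fun n => S r.+1 n.+1 - S r.+1 n).
    by apply/funext => n; rewrite SS addrC addKr mulrC.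
  rewrite -(subrr (limn (S r.+1))); apply: cvgB => //.
  by rewrite (cvg_shiftS (S r.+1)).
(* The boundary term in [SE] pairs x^(n+1) with index n: undo the shift, then multiply by one more
   factor x. *)
have {}H0 : (fun n => x ^+ n.+1 * hyperharmonic R r.+1 n) @ \oo --> (0 : R).
  have : (fun n => x ^+ n * hyperharmonic R r.+1 n) @ \oo --> (0 : R).
    by rewrite -(cvg_shiftS (fun n => x ^+ n * hyperharmonic R r.+1 n)).
  move=> /(@cvgMl_tmp _ _ _ _ _ x); rewrite mulr0.
  by under eq_fun do rewrite mulrA -exprS.
rewrite (_ : (fun n => _) = S r.+1) //; under [S r.+1]funext do rewrite SE.
rewrite exprSr invfM mulrA -[X in X / (1 - x)]subr0.
by apply: cvgMr_tmp; exact: cvgB.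
Qed.

End GeneratingFunction.

(** * Laplace transform of monomials and Gamma at positive integers *)

Section LaplaceMonomial.
Context {R : realType}.
Implicit Types (k : nat) (a t : R).

(** The antiderivative of t^k e^(-at) obtained by repeated integration by parts, normalised to
    vanish at +oo when a > 0. *)
Fixpoint laplace_primitive a k t : R :=
  if k is k'.+1 then
    k%:R / a * laplace_primitive a k' t - t ^+ k * expR (- (a * t)) / a
  else - expR (- (a * t)) / a.

Lemma is_derive_laplace_primitive a k t : a != 0 ->
  is_derive t (1 : R) (laplace_primitive a k) (t ^+ k * expR (- (a * t))).
Proof.
move=> a0.
have dE : is_derive t (1 : R) (fun t => expR (- (a * t))) (- a * expR (- (a * t))).
  have dl : is_derive t (1 : R) (fun t : R => - (a * t)) (- a).
    by apply: is_derive_eq; rewrite /GRing.scale /= mulr1.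
  have := @is_derive1_comp _ (@expR R) (fun t => - (a * t)) t _ _ (is_derive_expR _) dl.
  by rewrite mulrC.
elim: k => [|k ih] /=.
  have -> : (fun t => - expR (- (a * t)) / a) = (fun t => (- a^-1) *: expR (- (a * t))).
    by apply/funext => z; rewrite /GRing.scale /= mulrC mulrN mulNr.
  apply: (is_derive_eq (is_deriveZ (- a^-1) dE)).
  rewrite /GRing.scale /= expr0; by field.
have -> : (fun t => k.+1%:R / a * laplace_primitive a k t
                    - t ^+ k.+1 * expR (- (a * t)) / a)
        = (fun t => k.+1%:R / a *: laplace_primitive a k t
                    - a^-1 *: (t ^+ k.+1 * expR (- (a * t)))).
  by apply/funext => z; rewrite /GRing.scale /= [_ / a in X in _ - X]mulrC.
have dX := is_derive_exprn k.+1 t.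
apply: (is_derive_eq (is_deriveB (is_deriveZ (k.+1%:R / a) ih)
  (is_deriveZ a^-1 (is_deriveM dX dE)))).
rewrite /GRing.scale /= exprS.
by field.
Qed.

Lemma laplace_primitive0 a k : a != 0 ->
  laplace_primitive a k 0 = - (k`!%:R / a ^+ k.+1).
Proof.
move=> a0; elim: k => [|k ih] /=; first by rewrite mulr0 oppr0 expR0 fact0 expr1 mulNr.
rewrite ih expr0n /= !mul0r subr0 factS natrM !exprS.
by field; rewrite expf_neq0.
Qed.

Lemma cvg_exprn_expRN a k : 0 < a ->
  t ^+ k * expR (- (a * t)) @[t --> +oo] --> (0 : R).
Proof.
move=> a0.
(* Chosen so that (C / t) (at)^(k+1) / (k+1)! = t^k; the exponential dominates its Taylor term of
   degree k + 1, which leaves the bound C / t. *)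
pose C : R := k.+1`!%:R / a ^+ k.+1.
apply: (@squeeze_cvgr _ _ _ _ (cst 0) (fun t => C * t^-1)).
- near=> t.
  have t0 : 0 < t by near: t; exact: nbhs_pinfty_gt.
  rewrite mulr_ge0 ?exprn_ge0 ?expR_ge0 ?(ltW t0) //=.
  rewrite expRN ler_pdivrMr ?expR_gt0 //.
  have h := @expR_ge1Dxn R (a * t) k (mulr_ge0 (ltW a0) (ltW t0)).
  have fk : 0 < k.+1`!%:R :> R by rewrite ltr0n fact_gt0.
  apply: (@le_trans _ _ (C / t * ((a * t) ^+ k.+1 / k.+1`!%:R))).
    rewrite /C exprMn (exprSr t) le_eqVlt; apply/orP; left; apply/eqP.
    by field; rewrite !gt_eqF // exprn_gt0.
  rewrite ler_wpM2l //.
    by rewrite !mulr_ge0 ?invr_ge0 ?exprn_ge0 ?ltW.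
  by apply: le_trans h; rewrite lerDr.
- exact: cvg_cst.
- rewrite -[X in _ --> X](mulr0 C); apply: cvgMl_tmp.
  apply/gtr0_cvgV0; last exact: cvg_id.
  near=> t; near: t; exact: nbhs_pinfty_gt.
Unshelve. all: by end_near. Qed.

Lemma cvg_laplace_primitive a k : 0 < a ->
  laplace_primitive a k t @[t --> +oo] --> (0 : R).
Proof.
move=> a0; elim: k => [|k ih] /=.
  have := cvg_exprn_expRN a 0 a0; under eq_fun do rewrite expr0 mul1r.
  move=> h.
  have : - expR (- (a * t)) / a @[t --> +oo] --> - 0 / a.
    by apply: cvgMr_tmp; exact: cvgN.
  by rewrite oppr0 mul0r.
have : k.+1%:R / a * laplace_primitive a k t - t ^+ k.+1 * expR (- (a * t)) / a
    @[t --> +oo] --> k.+1%:R / a * 0 - 0 / a.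
  apply: cvgB; first exact: cvgMl_tmp.
  by apply: cvgMr_tmp; exact: cvg_exprn_expRN.
by rewrite mulr0 mul0r subr0.
Qed.

Lemma continuous_exprn_expRN a k : continuous (fun t => t ^+ k * expR (- (a * t))).
Proof.
move=> t; apply: cvgM; first exact: exprn_continuous.
apply: continuous_comp; last exact: continuous_expR.
by apply: cvgN; apply: cvgMl_tmp.
Qed.

Lemma measurable_exprn_expRN a k (D : set R) :
  measurable_fun D (fun t => t ^+ k * expR (- (a * t))).
Proof.
apply: measurable_funTS; apply: continuous_measurable_fun.
exact: continuous_exprn_expRN.
Qed.

Lemma integral_exprn_expRN a k : 0 < a ->
  (\int[lebesgue_measure]_(t in `]0%R, +oo[) (t ^+ k * expR (- (a * t)))%:E
   = (k`!%:R / a ^+ k.+1)%:E)%E.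
Proof.
move=> a0.
have a0' : a != 0 by rewrite gt_eqF.
have dP t := is_derive_laplace_primitive a k t a0'.
(* Adding the null endpoint 0 gives the closed half-line on which the fundamental theorem of
   calculus is applied. *)
rewrite integral_itv_obnd_cbnd; last first.
  apply/measurable_EFinP; exact: measurable_exprn_expRN.
rewrite (@ge0_continuous_FTC2y _ _ (laplace_primitive a k) _ 0) //.
- by rewrite laplace_primitive0 // -EFinB sub0r opprK.
- by move=> t t0; rewrite mulr_ge0 ?expR_ge0 ?exprn_ge0.
- exact/continuous_subspaceT/continuous_exprn_expRN.
- exact: cvg_laplace_primitive.
- apply/cvg_at_right_filter/differentiable_continuous/derivable1_diffP.
  by have [] := dP 0.
- by move=> t _; rewrite derive1E; apply: derive_val.
Qed.

(** The case a = 1 of the Laplace integral; on t > 0 the real power agrees with the natural one. *)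
Lemma Gamma_nat k : Gamma (k.+1%:R : R) = k`!%:R.
Proof.
rewrite /Gamma /Rintegral.
rewrite -[RHS]/(fine (k`!%:R)%:E); congr fine.
rewrite -[k`!%:R in RHS]divr1 -[X in _ / X](expr1n _ k.+1) -integral_exprn_expRN //.
apply: eq_integral => t; rewrite inE /= in_itv /= andbT => t0.
by rewrite mul1r -natr1 addrK powR_mulrn ?ltW.
Qed.

End LaplaceMonomial.

(** * Partial sums of the integrand and their integrals *)

Section PartialIntegrand.
Context {R : realType}.
Implicit Types (r m n k : nat) (t : R).
Local Notation mu := (@lebesgue_measure R).

Definition hyperharmonic_partial m r n t : R :=
  \sum_(1 <= k < n.+1) hyperharmonic R r k * (t ^+ m.-1 * expR (- (k%:R * t))).

Lemma hyperharmonic_partial_ge0 m r n t : 0 <= t -> 0 <= hyperharmonic_partial m r n t.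
Proof.
move=> t0; apply: sumr_ge0 => k _.
by rewrite !mulr_ge0 ?hyperharmonic_ge0 ?exprn_ge0 ?expR_ge0.
Qed.

(** The generating function at x = e^(-t), which lies in [0, 1) because t > 0. *)
Lemma cvg_hyperharmonic_partial m r t : 0 < t ->
  hyperharmonic_partial m r n t @[n --> \oo] --> - hyperharmonic_integrand m r t.
Proof.
move=> t0.
have x01 : 0 <= expR (- t) < 1 by rewrite expR_ge0 expR_lt1 oppr_lt0.
have -> : (hyperharmonic_partial m r)^~ t =
    (fun n => t ^+ m.-1 * \sum_(1 <= k < n.+1) hyperharmonic R r k * expR (- t) ^+ k).
  apply/funext => n; rewrite /hyperharmonic_partial mulr_sumr.
  by apply: eq_bigr => k _; rewrite -mulrN expRM_natl mulrCA.
rewrite /hyperharmonic_integrand -mulNr -mulrN -mulrA.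
exact: cvgMl_tmp (hyperharmonic_series r _ x01).
Qed.

Lemma measurable_hyperharmonic_partial m r n (D : set R) :
  measurable_fun D (hyperharmonic_partial m r n).
Proof.
apply: (@measurable_sum _ _ _ _ _ _ (fun k t =>
  hyperharmonic R r k * (t ^+ m.-1 * expR (- (k%:R * t))))) => k.
apply: measurable_funM; first exact: measurable_cst.
exact: measurable_exprn_expRN.
Qed.

Lemma integral_hyperharmonic_partial m r n :
  (\int[mu]_(t in `]0%R, +oo[) (hyperharmonic_partial m.+1 r n t)%:E
   = (m`!%:R * \sum_(1 <= k < n.+1) hyperharmonic R r k / k%:R ^+ m.+1)%:E)%E.
Proof.
under eq_integral do rewrite -sumEFin.
rewrite ge0_integral_sum //; last first.
  - move=> k t /=; rewrite in_itv /= andbT => t0.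
    by rewrite lee_fin !mulr_ge0 ?hyperharmonic_ge0 ?exprn_ge0 ?expR_ge0 ?(ltW t0).
  - move=> k; apply/measurable_EFinP; apply: measurable_funM => //.
    exact: measurable_exprn_expRN.
rewrite mulr_sumr -sumEFin; apply: eq_big_nat => k /andP[k1 _].
under eq_integral do rewrite EFinM.
rewrite ge0_integralZl_EFin //; last 3 first.
  - move=> t /=; rewrite in_itv /= andbT => t0.
    by rewrite lee_fin mulr_ge0 ?exprn_ge0 ?expR_ge0 ?(ltW t0).
  - by apply/measurable_EFinP; exact: measurable_exprn_expRN.
  - exact: hyperharmonic_ge0.
rewrite integral_exprn_expRN ?ltr0n // -EFinM; congr EFin; ring.
Qed.

End PartialIntegrand.

(** * Monotone convergence, integrability and the final identity *)

Theorem theorem1 (R : realType) (m r : nat) (hr : (1 <= r)%N) (hm : (r < m)%N) :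
  (@lebesgue_measure R).-integrable `]0, +oo[
    (EFin \o hyperharmonic_integrand m r) /\
  (fun N : nat => \sum_(1 <= n < N.+1) (hyperharmonic R r n / n%:R ^+ m))
    @ \oo -->
  - (Gamma (m%:R : R))^-1 *
    \int[lebesgue_measure]_(t in `]0, +oo[) hyperharmonic_integrand m r t.
Proof.
(* The case m = 0 contradicts r < m; from here the exponent is [m.+1], and its Gamma value is m!. *)
case: m hm => // m hm.
set f := hyperharmonic_integrand m.+1 r.
set S := fun N : nat => \sum_(1 <= n < N.+1) (hyperharmonic R r n / n%:R ^+ m.+1).
pose D : set R := `]0, +oo[%classic.
have mD : measurable D by exact: measurable_itv.
have posD t : D t -> 0 < t by rewrite /D /= in_itv /= andbT.
have g_f t : D t -> hyperharmonic_partial m.+1 r n t @[n --> \oo] --> - f t.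
  by move=> /posD; exact: cvg_hyperharmonic_partial.
(* Both the sign and the measurability of [- f] are inherited from the partial sums through the
   pointwise limit. *)
have f0 t : D t -> 0 <= - f t.
  move=> Dt; rewrite -(cvg_lim _ (g_f t Dt)) //; apply: limr_ge.
    by apply: cvgP (g_f t Dt).
  by apply: nearW => n; apply: hyperharmonic_partial_ge0; exact/ltW/posD.
have mNf : measurable_fun D (fun t => - f t).
  apply: (@measurable_fun_cvg _ _ _ _ _ _ _ g_f) => n.
  exact: measurable_hyperharmonic_partial.
have mf : measurable_fun D f.
  rewrite (_ : f = \- (fun t => - f t)); first exact: measurable_funN.
  by apply/funext => t /=; rewrite opprK.
have Scvg : cvgn S.
  apply: nondecreasing_is_cvgn.
    by apply: hyperharmonic_series_homo => k; rewrite invr_ge0 exprn_ge0.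
  by exists 3 => _ [n _ <-]; exact: hyperharmonic_partial_sum_le.
have intNf : (\int[lebesgue_measure]_(t in D) (- f t)%:E = (m`!%:R * limn S)%:E)%E.
  have -> : (\int[lebesgue_measure]_(t in D) (- f t)%:E = \int[lebesgue_measure]_(t in D)
      limn (fun n => (hyperharmonic_partial m.+1 r n t)%:E))%E.
    apply: eq_integral => t; rewrite inE => Dt; apply/esym/cvg_lim => //.
    by apply/fine_cvgP; split; [exact: nearW | exact: g_f].
  (* The partial sums are nonnegative and increase with [n], so limit and integral commute. *)
  rewrite monotone_convergence //; last 3 first.
  - by move=> n; apply/measurable_EFinP; exact: measurable_hyperharmonic_partial.
  - by move=> n t /posD/ltW; rewrite lee_fin; exact: hyperharmonic_partial_ge0.
  - move=> t /posD/ltW t0 n p np; rewrite lee_fin.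
    apply: hyperharmonic_series_homo np => k.
    by rewrite mulr_ge0 ?exprn_ge0 ?expR_ge0.
  apply/cvg_lim => //.
  under eq_fun do rewrite integral_hyperharmonic_partial.
  by apply/fine_cvgP; split; [exact: nearW | exact: cvgMl_tmp].
have m0 : m`!%:R != 0 :> R by rewrite pnatr_eq0 -lt0n fact_gt0.
have intf : (\int[lebesgue_measure]_(t in D) (f t)%:E = - (m`!%:R * limn S)%:E)%E.
  rewrite -intNf -integral_ge0N //.
  by apply: eq_integral => t _; rewrite -EFinN opprK.
split.
  (* On [D] the absolute value of [f] is [- f], whose integral was just found to be finite. *)
  apply/integrableP; split; first exact/measurable_EFinP.
  rewrite (_ : (\int[_]_(t in _) _)%E = (m`!%:R * limn S)%:E) ?ltry // -intNf.
  apply: eq_integral => t; rewrite inE => Dt /=.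
  by rewrite -normrN ger0_norm // f0.
by rewrite /Rintegral intf /= Gamma_nat mulrN mulNr opprK mulKf.
Qed.
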